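(* Let $p,q\ge 2$ be integers and let $r:(\mathbb{Z}/p\mathbb{Z})\setminus\{0\}\to\mathbb{Z}$ be a function with $qj+r(j)\ge 1$ for all $j=1,\dots,p-1$, and let $C$ be the associated Collatz-like map. Assume that $p$ and $q$ are coprime, that $q<p^{p/(p-1)}$, and that $qj+r(j)\equiv 0\pmod p$ for all $j=1,\dots,p-1$. Assume further that $r(j)\ge 0$ for all $j$. Let $\gamma=\frac{p-1}{p}\log_p q$. Then for every $c>0$ the set $$\{N\in\mathbb{N}: C_{\min}(N)<N^{\gamma+c}\}$$ has natural density $1$.
   Context: $\mathbb{N}=\{1,2,3,\dots\}$. The map $C:\mathbb{N}\to\mathbb{N}$ is $C(N)=N/p$ if $N\equiv 0\pmod p$, and $C(N)=qN+r(j)$ if $N\equiv j\pmod p$ with $j\in\{1,\dots,p-1\}$. $C_{\min}(N)=\min_{k\ge0}C^k(N)$, where $C^k$ denotes the $k$-th iterate. The natural density of $A\subset\mathbb{N}$ is $\lim_{N\to\infty}\#(A\cap\{1,\dots,N\})/N$, when it exists. $\log_p$ is the logarithm in base $p$. *)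

(* Defs.v *)
From mathcomp Require Import all_boot all_order all_algebra.
From mathcomp Require Import all_classical all_reals all_analysis.
Import Order.TTheory GRing.Theory Num.Theory.
Import numFieldNormedType.Exports.

Set Implicit Arguments.
Unset Strict Implicit.
Unset Printing Implicit Defensive.

Local Open Scope classical_set_scope.
Local Open Scope ring_scope.

(* r is meant on (Z/pZ) \ {0}: the value r 0 is never used. absz only casts
   int to nat, and is harmless for N > 0 as soon as q j + r(j) >= 1 for
   0 < j < p: see collatz_nondvd. *)
Definition collatz (p q : nat) (r : 'Z_p -> int) (N : nat) : nat :=
  if (p %| N)%N then (N %/ p)%N else absz (q%:Z * N%:Z + r N%:R).

Arguments collatz : clear implicits.

Lemma collatz_nondvd (p q : nat) (r : 'Z_p -> int) (N : nat) :
  (1 < p)%N ->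
  (forall j : nat, (0 < j < p)%N -> 1 <= q%:Z * j%:Z + r j%:R) ->
  ~~ (p %| N)%N ->
  (collatz p q r N)%:Z = q%:Z * N%:Z + r N%:R /\ (0 < collatz p q r N)%N.
Proof.
move=> p1 rj pN; rewrite /collatz (negbTE pN).
have pgt0 : (0 < p)%N by apply: ltnW.
have jP : (0 < N %% p < p)%N by rewrite ltn_mod pgt0 lt0n pN.
have rE : r N%:R = r (N %% p)%:R.
  by congr r; apply: val_inj; rewrite /= !val_Zp_nat // modn_mod.
have le1 : 1 <= q%:Z * N%:Z + r N%:R.
  rewrite rE; apply: (le_trans (rj _ jP)); rewrite lerD2r.
  by rewrite ler_wpM2l // lez_nat leq_mod.
have e : (absz (q%:Z * N%:Z + r N%:R))%:Z = q%:Z * N%:Z + r N%:R.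
  by rewrite gez0_abs // (le_trans _ le1).
by split=> //; rewrite -ltz_nat e; apply: lt_le_trans le1.
Qed.

Lemma orbit_nonempty (f : nat -> nat) (N : nat) :
  exists m, `[< exists k, m = iter k f N >].
Proof. by exists N; apply/asboolP; exists 0%N. Qed.

Definition orbit_min (f : nat -> nat) (N : nat) : nat :=
  ex_minn (orbit_nonempty f N).

Definition has_natural_density (R : realType) (A : set nat) (d : R) : Prop :=
  (fun N : nat => (count (fun n => `[< A n >]) (iota 1 N))%:R / N%:R : R)
    @ \oo --> d.

Definition log_base (R : realType) (b x : R) : R := ln x / ln b.

(* Main.v *)
Require Import Defs.
From mathcomp Require Import all_boot all_order all_algebra.
From mathcomp Require Import all_classical all_reals all_analysis.
From mathcomp Require Import lra ring zify.
Import Order.TTheory GRing.Theory Num.Theory.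
Import numFieldNormedType.Exports.

Local Open Scope classical_set_scope.
Local Open Scope ring_scope.

(** The proof follows the method of Terras and Korec, for all the maps
    [T (M * p + j) = a j * M + b j] with every [a j] coprime to [p]. The
    Collatz-like map is of this kind once each step [q N + r] is merged with
    the division by [p] that always follows it; then [a 0 = 1], and [a j = q]
    for the other residues.

    The residues mod [p] of [N, T N, ..., T^(n-1) N] depend only on [N] mod
    [p ^ n], and since the affine maps [M => a j * M + b j] permute the
    residues mod [p ^ n], these [n] residues behave as independent uniform
    variables when [N] is uniform mod [p ^ n]. So the sum of
    [ln (a j)] along [n] steps has mean [n * mu], with
    [mu = (\sum_(j < p) ln (a j)) / p], and a variance linear in [n]
    (residue_sum_variance).

    Let [gamma = mu / ln p], which is [(p - 1) / p * log_p q] for the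
    Collatz-like map, and suppose that the whole orbit of a large [N] stays
    above [N ^ (gamma + c)]. Every term of the orbit is then so large that the
    shift [b j] raises its logarithm by at most a small [delta], whence
    [ln (T^n N) <= ln N + (sum of the ln (a j)) - n (ln p - delta)].
    For [N] of size about [p ^ n] the left side is at least about
    [(gamma + c) n ln p = n mu + c n ln p], whereas the right side is about
    the sum itself plus [n delta]. The sum thus exceeds its mean by a positive
    multiple of [n] (high_orbit_deviation), and by Chebyshev's inequality this
    occurs for a proportion [O(1/n)] of the [N] below [p ^ n]
    (high_orbit_sparse). Arguing on orbits that never descend is what makes a
    single deviation estimate, at time [n], sufficient: it bounds the
    accumulated effect of the shifts without any control of the sums at
    intermediate times. *)

(** * Equidistribution of residues along orbits *)

Lemma sum_base_digits (V : nmodType) (f : nat -> V) (m p : nat) :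
  \sum_(N < m * p) f N = \sum_(j < p) \sum_(M < m) f (M * p + j)%N.
Proof.
rewrite -(big_mkord xpredT f) big_nat_mul big_mkord exchange_big /=.
apply: eq_bigr => M _; rewrite mulSn addnC -{1}(add0n (M * p)%N).
rewrite big_addn addKn big_mkord.
by apply: eq_bigr => j _; rewrite addnC.
Qed.

(** An affine map with multiplier coprime to [m] permutes the residues mod [m]. *)
Lemma sum_affine_residues (V : nmodType) (f : nat -> V) (m a b : nat) :
  coprime a m -> (forall x y, x = y %[mod m] -> f x = f y) ->
  \sum_(M < m) f (a * M + b)%N = \sum_(M < m) f M.
Proof.
case: m => [|m] cop fper; first by rewrite !big_ord0.
pose h (M : 'I_m.+1) : 'I_m.+1 := inord ((a * M + b) %% m.+1).
have hE M : h M = ((a * M + b) %% m.+1)%N :> nat.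
  by rewrite inordK // ltn_mod.
have le_inj (x y : 'I_m.+1) : (x <= y)%N -> h x = h y -> x = y.
  move=> lexy /(congr1 val); rewrite /= !hE => /esym/eqP.
  rewrite eqn_modDr eqn_mod_dvd ?leq_mul2l ?lexy ?orbT // -mulnBr.
  rewrite Gauss_dvdr 1?coprime_sym // -eqn_mod_dvd //.
  by rewrite !modn_small // => /eqP/esym/val_inj.
have h_inj : injective h.
  move=> x y; case/orP: (leq_total x y) => le_xy; first exact: le_inj.
  by move=> /esym/(le_inj _ _ le_xy).
rewrite [RHS](reindex_inj h_inj); apply: eq_bigr => M _.
by apply: fper; rewrite hE modn_mod.
Qed.

Definition residue_map (p : nat) (a b : nat -> nat) (N : nat) : nat :=
  (a (N %% p) * (N %/ p) + b (N %% p))%N.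

Definition residue_sum (V : nmodType) (p : nat) (T : nat -> nat)
    (e : nat -> V) (n N : nat) : V :=
  \sum_(k < n) e (iter k T N %% p)%N.

Lemma residue_sumS (V : nmodType) p T (e : nat -> V) n N :
  residue_sum V p T e n.+1 N = e (N %% p)%N + residue_sum V p T e n (T N).
Proof.
rewrite /residue_sum big_ord_recl; congr (_ + _).
by apply: eq_bigr => k _; rewrite /= -iterS iterSr.
Qed.

Lemma residue_map_digits p a b M j : (j < p)%N ->
  residue_map p a b (M * p + j) = (a j * M + b j)%N.
Proof.
move=> jp; have p0 := leq_ltn_trans (leq0n j) jp.
by rewrite /residue_map modnMDl divnMDl // modn_small // divn_small // addn0.
Qed.

(** Each step of [residue_map] divides by [p], so it consumes one base [p]
    digit: the first [n] residues are determined by the last [n] digits. *)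
Lemma residue_sum_period (V : nmodType) p a b (e : nat -> V) n x y :
  x = y %[mod p ^ n] ->
  residue_sum V p (residue_map p a b) e n x =
  residue_sum V p (residue_map p a b) e n y.
Proof.
elim: n x y => [|n IHn] x y eq_xy; first by rewrite /residue_sum !big_ord0.
have eq_p : x = y %[mod p].
  rewrite -(modn_dvdm x (dvdn_exp (ltn0Sn n) (dvdnn p))) eq_xy.
  by rewrite modn_dvdm ?dvdn_exp.
rewrite !residue_sumS eq_p; congr (_ + _); apply: IHn.
have eq_div : x %/ p = y %/ p %[mod p ^ n] by rewrite !modn_divl -expnSr eq_xy.
by rewrite /residue_map eq_p -modnDml -modnMmr eq_div modnMmr modnDml.
Qed.

Section Moments.
Variables (F : comPzRingType) (p : nat) (a b : nat -> nat) (e : nat -> F).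
Hypothesis cop_a : forall j, (j < p)%N -> coprime (a j) p.
Hypothesis mean_e : \sum_(j < p) e j = 0.

Let S := residue_sum F p (residue_map p a b) e.

(** The independence of the successive residues, in the form used to compute
    moments: after the first residue [j], the rest of the orbit starts from
    [a j * M + b j], which is equidistributed mod [p ^ n] whatever [j] is. *)
Lemma sum_first_digit (g : F -> F) n :
  \sum_(N < p ^ n.+1) g (S n.+1 N) =
  \sum_(j < p) \sum_(M < p ^ n) g (e j + S n M).
Proof.
rewrite expnSr (sum_base_digits _ (fun N => g (S n.+1 N))); apply: eq_bigr => j _.
under eq_bigr => M _ do
  rewrite /S residue_sumS modnMDl modn_small // residue_map_digits //.
apply: (sum_affine_residues _ (fun M => g (e j + S n M))).
  by rewrite coprimeXr ?cop_a.
by move=> x y eq_xy; rewrite /S (residue_sum_period _ _ _ _ _ _ _ _ eq_xy).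
Qed.

Lemma residue_sum_mean n : \sum_(N < p ^ n) S n N = 0.
Proof.
elim: n => [|n IHn].
  by rewrite big1 // => N _; rewrite /S /residue_sum big_ord0.
rewrite (sum_first_digit id) /=.
under eq_bigr => j _ do rewrite big_split /= IHn addr0 sumr_const card_ord.
by rewrite sumrMnl mean_e mul0rn.
Qed.

(** Variances add up over the [n] steps, because the cross terms vanish by
    [residue_sum_mean]. *)
Lemma residue_sum_variance n :
  p%:R * (\sum_(N < p ^ n) S n N ^+ 2) =
  (n * p ^ n)%:R * \sum_(j < p) e j ^+ 2.
Proof.
elim: n => [|n IHn].
  rewrite mul0n mul0r big1 ?mulr0 // => N _.
  by rewrite /S /residue_sum big_ord0 expr0n.
rewrite (sum_first_digit (fun x => x ^+ 2)) /=.
have -> : \sum_(j < p) \sum_(M < p ^ n) (e j + S n M) ^+ 2 =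
    (p ^ n)%:R * \sum_(j < p) e j ^+ 2 + p%:R * \sum_(N < p ^ n) S n N ^+ 2.
  have sq (j : 'I_p) : \sum_(M < p ^ n) (e j + S n M) ^+ 2 =
      (p ^ n)%:R * e j ^+ 2 + \sum_(M < p ^ n) S n M ^+ 2.
    under eq_bigr => M _ do rewrite sqrrD.
    rewrite !big_split /= sumr_const card_ord -[_ *+ (p ^ n)]mulr_natl.
    by rewrite -mulr_sumr residue_sum_mean mulr0 !addr0.
  under eq_bigr => j _ do rewrite sq.
  by rewrite big_split /= -mulr_sumr sumr_const card_ord [p%:R * _]mulr_natl.
rewrite IHn -mulrDl mulrA -natrD -natrM; congr (_%:R * _).
by rewrite expnS; lia.
Qed.
End Moments.

(** * Logarithmic growth along large orbits *)

Section LogGrowth.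
Variables (R : realType) (p : nat) (a b : nat -> nat).
Hypothesis p_gt1 : (1 < p)%N.
Hypothesis a_gt0 : forall j, (j < p)%N -> (0 < a j)%N.

Let T := residue_map p a b.
Let K := (\max_(j < p) b j)%N.

(** As [p * T x <= a j * x + p * K] and [a j >= 1], the shift costs at most a
    factor [1 + delta], hence [delta] in the logarithm, as soon as
    [p * K <= delta * x]. *)
Lemma ln_residue_map_le (delta : R) (x : nat) :
  0 < delta -> (0 < x)%N -> (0 < T x)%N -> (p * K)%:R <= delta * x%:R ->
  ln (T x)%:R <= ln x%:R + ln (a (x %% p)%N)%:R - ln p%:R + delta.
Proof.
move=> d0 x0 Tx0 Kx.
have p0 : (0 < p)%N by apply: ltnW.
pose j := Ordinal (ltn_pmod x p0).
have aj0 : (0 < a j)%N by apply: a_gt0.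
have bK : (b j <= K)%N by apply: (@leq_bigmax _ (fun i : 'I_p => b i) j).
have leT : (p * T x)%:R <= (a j * x)%:R + (p * K)%:R :> R.
  rewrite -natrD ler_nat /T /residue_map mulnDr leq_add ?leq_mul2l ?bK ?orbT //.
  by rewrite mulnCA leq_mul2l mulnC leq_trunc_div orbT.
have x1 : x%:R <= (a j * x)%:R :> R by rewrite ler_nat leq_pmull.
have leT' : (p * T x)%:R <= (a j * x)%:R * (1 + delta).
  apply: (le_trans leT); rewrite mulrDr mulr1 lerD2l (le_trans Kx) //.
  by rewrite mulrC ler_wpM2r // ltW.
have d1 : 0 < 1 + delta by rewrite addr_gt0.
have ax0 : 0 < (a j * x)%:R :> R by rewrite ltr0n muln_gt0 aj0.
have pT0 : 0 < (p * T x)%:R :> R by rewrite ltr0n muln_gt0 p0.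
have rhs0 : 0 < (a j * x)%:R * (1 + delta) by rewrite mulr_gt0.
have leln : ln (p * T x)%:R <= ln ((a j * x)%:R * (1 + delta)).
  by rewrite ler_ln ?posrE.
rewrite (lnM ax0 d1) !natrM !lnM ?posrE ?ltr0n //= in leln.
have d2 : -1 < delta by lra.
by have := le_ln1Dx d2; lra.
Qed.

Lemma ln_iter_le (delta : R) (n N : nat) : 0 < delta ->
  (forall k, (0 < iter k T N)%N /\ (p * K)%:R <= delta * (iter k T N)%:R) ->
  ln (iter n T N)%:R <=
  ln N%:R + residue_sum R p T (fun j => ln (a j)%:R) n N
    - n%:R * (ln p%:R - delta).
Proof.
move=> d0 big; elim: n => [|n IHn].
  by rewrite /residue_sum big_ord0 mul0r addr0 subr0.
have [x0 Kx] := big n; have [Tx0 _] := big n.+1.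
have := ln_residue_map_le delta (iter n T N) d0 x0 Tx0 Kx.
rewrite /residue_sum big_ord_recr -natr1 mulrDl mul1r /=.
by move: IHn; rewrite /residue_sum; lra.
Qed.
End LogGrowth.

(** * Orbits that never descend *)

(** The linear arithmetic that turns the growth bound into a lower bound on the
    deviation, with [x = ln N], [y = ln (T^n N)] and [X] the sum of the
    [ln (a j)]. *)
Lemma deviation_arith (F : realFieldType) (n m s L mu c d x y X : F) :
  s * L = mu + c * L -> c * L = 4 * d -> 0 <= m * (c * L) ->
  s * ((n - m) * L) <= s * x -> x <= n * L ->
  2 * s * m * L <= (n - m) * c * L -> s * x <= y ->
  y <= x + X - n * (L - d) -> n * d <= X - n * mu.
Proof.
move=> sL cL m0 sx xL cm xy yX.
have e1 : s * ((n - m) * L) = n * (s * L) - s * m * L by ring.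
have e2 : (n - m) * c * L = n * (c * L) - m * (c * L) by ring.
have e3 : 2 * s * m * L = 2 * (s * m * L) by ring.
rewrite e1 sL cL in sx; rewrite e2 e3 cL in cm; rewrite cL in m0.
lra.
Qed.

Lemma count_iota_le (F : numDomainType) (P : pred nat) (g : nat -> F)
    (X M : nat) :
  (X < M)%N -> (forall N, 0 <= g N) ->
  (forall N, (0 < N < M)%N -> P N -> 1 <= g N) ->
  (count P (iota 1 X))%:R <= \sum_(N < M) g N.
Proof.
move=> XM g0 Pg; rewrite -sum1_count natr_sum big_mkcond /=.
rewrite -(big_mkord xpredT g) (big_cat_nat (n := 1)) //=;
  last exact: leq_ltn_trans XM.
rewrite ler_wpDl ?sumr_ge0 // (big_cat_nat (n := X.+1)) //=.
rewrite ler_wpDr ?sumr_ge0 // [in leRHS]/index_iota subn1 /=.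
rewrite big_seq [leRHS]big_seq; apply: ler_sum => N.
rewrite mem_iota add1n => /andP[N0 NX].
by case: ifP => // PN; apply: Pg => //; rewrite N0 (leq_trans NX).
Qed.

Section HighOrbits.
Variables (R : realType) (p : nat) (a b : nat -> nat).
Hypothesis p_gt1 : (1 < p)%N.
Hypothesis cop_a : forall j, (j < p)%N -> coprime (a j) p.

Let T := residue_map p a b.
Let mean_ln : R := (\sum_(j < p) ln (a j)%:R) / p%:R.
Let gamma : R := mean_ln / ln p%:R.
Let dev (j : nat) : R := ln (a j)%:R - mean_ln.
Let S := residue_sum R p T dev.

Variable c : R.
Hypothesis c_gt0 : 0 < c.

Definition high_orbit (N : nat) : Prop :=
  (0 < N)%N /\ forall k, N%:R `^ (gamma + c) <= (iter k T N)%:R.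

Lemma coef_gt0 j : (j < p)%N -> (0 < a j)%N.
Proof.
move=> jp; rewrite lt0n; apply: contraTneq (cop_a j jp) => ->.
by rewrite /coprime gcd0n; lia.
Qed.

Lemma ln_base_gt0 : 0 < ln p%:R :> R.
Proof. by rewrite ln_gt0 // ltr1n. Qed.

Lemma mean_ln_ge0 : 0 <= mean_ln.
Proof.
apply: divr_ge0 => //; apply: sumr_ge0 => j _.
by rewrite ln_ge0 // ler1n coef_gt0.
Qed.

Lemma sum_dev : \sum_(j < p) dev j = 0.
Proof.
have p0 : p%:R != 0 :> R by rewrite pnatr_eq0; lia.
rewrite sumrB sumr_const card_ord -mulr_natl /mean_ln.
by rewrite mulrC divfK // subrr.
Qed.

Lemma residue_sum_dev n N :
  S n N = residue_sum R p T (fun j => ln (a j)%:R) n N - n%:R * mean_ln.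
Proof. by rewrite /S /residue_sum sumrB sumr_const card_ord mulr_natl. Qed.

(** Numbers below [p ^ (n - m)] are discarded, at the cost of a proportion
    of order [p ^ - m], so that [ln N] is [n * ln p] up to a bounded error and
    the threshold [N ^ (gamma + c)] tends to infinity with [n]. *)
Lemma high_orbit_deviation (m : nat) :
  exists n0, forall n, (n0 <= n)%N -> forall N, (p ^ (n - m) <= N < p ^ n)%N ->
    high_orbit N -> n%:R * (c * ln p%:R / 4) <= S n N.
Proof.
have pR0 : 0 < p%:R :> R by rewrite ltr0n ltnW.
have L0 := ln_base_gt0; have mu0 := mean_ln_ge0.
set L := ln p%:R in L0 *.
(* Of the gain [c * L = 4 * delta] per step, the shifts take [delta], the gap
   between [N] and [p ^ n] takes at most [2 * delta], and [delta] is left. *)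
pose s := gamma + c; pose delta := c * L / 4.
have s0 : 0 < s by rewrite ltr_wpDl // divr_ge0 // ltW.
have d0 : 0 < delta by rewrite divr_gt0 // mulr_gt0.
pose K := (\max_(j < p) b j)%N.
pose B := (p * K)%:R / delta + 1.
have B1 : 1 <= B by rewrite lerDr divr_ge0 // ltW.
have B0 : 0 < B by apply: lt_le_trans B1.
pose z := Num.max (ln B / (s * L)) (2 * s * m%:R / c).
(* The first term of [z] makes [N ^ s >= B]; the second makes the loss
   [s * m * L] in [s * ln N] at most half of [n * c * L]. *)
exists (m + Num.bound z)%N => n le_n N /andP[N_ge N_lt] [N0 orbN].
have zb : z < (Num.bound z)%:R.
  apply: archi_boundP; rewrite le_max; apply/orP; left.
  by rewrite divr_ge0 ?ln_ge0 // mulr_ge0 // ltW.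
have le_mn : (m <= n)%N by apply: leq_trans le_n; apply: leq_addr.
have z_le : z <= (n - m)%:R.
  by apply: (le_trans (ltW zb)); rewrite ler_nat leq_subRL.
move: z_le; rewrite ge_max => /andP[].
rewrite ler_pdivrMr ?mulr_gt0 // ler_pdivrMr // natrB // => lnB cm.
have ln_pow k : ln (p ^ k)%:R = k%:R * L by rewrite natrX lnXn // mulr_natl.
have pk0 k : (0 < (p ^ k)%:R :> R) by rewrite ltr0n expn_gt0 (ltnW p_gt1).
have NR0 : 0 < N%:R :> R by rewrite ltr0n.
have lnN_ge : (n%:R - m%:R) * L <= ln N%:R.
  by rewrite -natrB // -ln_pow ler_ln ?posrE // ler_nat.
have lnN_le : ln N%:R <= n%:R * L.
  by rewrite -ln_pow ler_ln ?posrE // ler_nat ltnW.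
have BN : B <= N%:R `^ s.
  rewrite -ler_ln ?posrE ?powR_gt0 ?ltr0n // ln_powR (le_trans lnB) //.
  by rewrite mulrC -mulrA [L * _]mulrC ler_pM2l.
have big k : (0 < iter k T N)%N /\ (p * K)%:R <= delta * (iter k T N)%:R.
  have Bx : B <= (iter k T N)%:R by apply: le_trans BN (orbN k).
  split; first by rewrite -(ltr0n R) (lt_le_trans B0).
  rewrite mulrC -ler_pdivrMr // (le_trans _ Bx) //.
  by rewrite lerDl.
have := ln_iter_le R p a b p_gt1 coef_gt0 delta n N d0 big.
have lnT : s * ln N%:R <= ln (iter n T N)%:R.
  rewrite -ln_powR ler_ln ?posrE ?powR_gt0 ?ltr0n //.
  by have [] := big n.
rewrite -/T -/L residue_sum_dev; set X := residue_sum _ _ _ _ _ _ => le_ln.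
have sL : s * L = mean_ln + c * L by rewrite mulrDl divfK // gt_eqF.
have dE : c * L = 4 * delta by rewrite /delta [RHS]mulrC divfK // pnatr_eq0.
have snL : s * ((n%:R - m%:R) * L) <= s * ln N%:R by rewrite ler_pM2l.
have cmL : 2 * s * m%:R * L <= (n%:R - m%:R) * c * L by rewrite ler_pM2r.
have m0 : 0 <= m%:R * (c * L) by rewrite mulr_ge0 // mulr_ge0 // ltW.
exact: (deviation_arith _ _ _ _ _ _ _ _ _ _ _ sL dE m0 snL lnN_le cmL lnT le_ln).
Qed.

(** Chebyshev's inequality at the scale [p ^ n] just above [X]; since
    [p ^ n <= p * X], a proportion of [p ^ n] is one of [X]. *)
Lemma high_orbit_sparse (eps : R) : 0 < eps ->
  exists X0, forall X, (X0 <= X)%N ->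
    (count (fun N => `[< high_orbit N >]) (iota 1 X))%:R <= eps * X%:R.
Proof.
move=> eps0; have p0 : (0 < p)%N by lia.
have pR0 : 0 < p%:R :> R by rewrite ltr0n.
have L0 := ln_base_gt0.
pose tau := c * ln p%:R / 4.
have tau0 : 0 < tau by rewrite divr_gt0 // mulr_gt0.
pose v := (\sum_(j < p) dev j ^+ 2) / p%:R.
have v0 : 0 <= v by rewrite divr_ge0 // sumr_ge0 // => j _; apply: sqr_ge0.
pose m := Num.bound (2 * p%:R / eps).
have [n0 dev_n0] := high_orbit_deviation m.
pose n1 := Num.bound (2 * p%:R * v / (eps * tau ^+ 2)).
exists (p ^ (n0 + m + n1))%N => X le_X.
pose n := (trunc_log p X).+1.
have X0 : (0 < X)%N by apply: leq_trans le_X; rewrite expn_gt0 p0.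
have X_lt : (X < p ^ n)%N by apply: trunc_log_ltn.
have X_ge : (p ^ n <= p * X)%N by rewrite expnS leq_mul2l trunc_logP ?orbT.
have n_gt : (n0 + m + n1 < n)%N by rewrite ltnS trunc_log_max.
have n_gt0 : 0 < n%:R :> R by rewrite ltr0n.
(* [g] dominates the indicator of the high orbits: the first term covers the
   small [N], the second is the Chebyshev majorant. *)
pose g N : R := ((N < p ^ (n - m))%N : nat)%:R + (S n N / (n%:R * tau)) ^+ 2.
have g_ge0 N : 0 <= g N by rewrite addr_ge0 // sqr_ge0.
apply: (@le_trans _ _ (\sum_(N < p ^ n) g N)).
  apply: count_iota_le => // N /andP[_ N_lt] /asboolP high_N.
  rewrite /g; case: ltnP => [_|N_ge]; first by rewrite lerDl sqr_ge0.
  rewrite add0r exprn_ege1 // ler_pdivlMr ?mulr_gt0 // mul1r.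
  apply: dev_n0; rewrite ?N_ge //; apply: leq_trans (ltnW n_gt) => //.
  by rewrite -addnA leq_addr.
have le_mn : (m <= n)%N.
  by apply: leq_trans (ltnW n_gt); rewrite addnAC leq_addl.
have small :
    \sum_(N < p ^ n) ((N < p ^ (n - m))%N : nat)%:R = (p ^ (n - m))%:R :> R.
  rewrite -[in RHS](card_ord (p ^ (n - m))) -sum1_card.
  rewrite (big_ord_widen (p ^ n) (fun=> 1%N)) ?leq_pexp2l ?leq_subr //.
  by rewrite [in RHS]big_mkcond natr_sum; apply: eq_bigr => N _; case: ifP.
have var : \sum_(N < p ^ n) S n N ^+ 2 = (n * p ^ n)%:R * v.
  apply: (mulfI (x := p%:R)); first by rewrite gt_eqF.
  rewrite residue_sum_variance //; last exact: sum_dev.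
  by rewrite mulrCA /v [p%:R * _]mulrC divfK // gt_eqF.
rewrite big_split /= small.
under eq_bigr => N _ do rewrite expr_div_n.
rewrite -mulr_suml var natrM.
have XR0 : 0 < X%:R :> R by rewrite ltr0n.
have PX : (p ^ n)%:R <= p%:R * X%:R :> R by rewrite -natrM ler_nat.
have n1_lt : 2 * p%:R * v / (eps * tau ^+ 2) < n%:R.
  apply: lt_le_trans (archi_boundP _) _.
    by rewrite divr_ge0 // mulr_ge0 // ?sqr_ge0 // ltW.
  by rewrite ler_nat (leq_trans _ (ltnW n_gt)) // leq_addl.
have m_lt : 2 * p%:R / eps < (p ^ m)%:R.
  apply: lt_le_trans (archi_boundP _) _; first by rewrite divr_ge0 // ltW.
  by rewrite ler_nat ltnW // ltn_expl.
rewrite [leRHS](splitr (eps * X%:R)); apply: lerD.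
  have pm0 : 0 < (p ^ m)%:R :> R by rewrite ltr0n expn_gt0 p0.
  rewrite -(ler_pM2r pm0) -natrM -expnD subnK // (le_trans PX) //.
  move: m_lt; rewrite ltr_pdivrMr // => /ltW; rewrite -(ler_pM2r XR0) => le_m.
  have -> : eps * X%:R / 2 * (p ^ m)%:R = (p ^ m)%:R * eps * X%:R / 2 by ring.
  by rewrite ler_pdivlMr // mulrC mulrA.
move: n1_lt; rewrite ltr_pdivrMr ?mulr_gt0 ?exprn_gt0 // => /ltW le_n.
have nX0 : 0 < n%:R * X%:R :> R by rewrite mulr_gt0.
rewrite -(ler_pM2l nX0) in le_n.
have le_P : n%:R * (p ^ n)%:R * v <= n%:R * (p%:R * X%:R) * v.
  by rewrite ler_wpM2r // ler_pM2l.
rewrite ler_pdivrMr ?exprn_gt0 ?mulr_gt0 // (le_trans le_P) //.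
have -> : eps * X%:R / 2 * (n%:R * tau) ^+ 2 =
    eps * X%:R * (n%:R * tau) ^+ 2 / 2 by ring.
rewrite ler_pdivlMr //.
have -> : n%:R * (p%:R * X%:R) * v * 2 = n%:R * X%:R * (2 * p%:R * v) by ring.
by apply: (le_trans le_n); rewrite le_eqVlt; apply/orP; left; apply/eqP; ring.
Qed.
End HighOrbits.

Lemma density_one_of_sparse (R : realType) (A B : set nat) :
  (forall N, (0 < N)%N -> ~ A N -> B N) ->
  (forall eps : R, 0 < eps -> exists X0, forall X, (X0 <= X)%N ->
    (count (fun N => `[< B N >]) (iota 1 X))%:R <= eps * X%:R) ->
  has_natural_density A (1 : R).
Proof.
move=> AB sparse; apply/cvgrPdist_le => eps /sparse[X0 B_le].
near=> X.
have X_gt0 : (0 < X)%N by near: X; exact: nbhs_infty_gt.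
have le_X : (X0 <= X)%N by near: X; exact: nbhs_infty_ge.
have XR0 : 0 < X%:R :> R by rewrite ltr0n.
pose P N := `[< A N >].
have cardX :
    (count P (iota 1 X))%:R = X%:R - (count (predC P) (iota 1 X))%:R :> R.
  by rewrite -{2}(size_iota 1 X) -(count_predC P) natrD addrK.
have -> : 1 - (count P (iota 1 X))%:R / X%:R =
    (count (predC P) (iota 1 X))%:R / X%:R :> R.
  by rewrite cardX mulrBl divff ?gt_eqF // opprB addrCA subrr addr0.
rewrite ger0_norm ?divr_ge0 // ler_pdivrMr //.
rewrite (le_trans _ (B_le X le_X)) // ler_nat.
rewrite -!sum1_count [leqLHS]big_mkcond [leqRHS]big_mkcond /=.
rewrite [leqLHS]big_seq [leqRHS]big_seq; apply: leq_sum => N.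
rewrite mem_iota /P => /andP[N_gt0 _]; case: (asboolP (A N)) => //= notA.
by case: (asboolP (B N)) => // notB; case: notB; apply: AB.
Unshelve. all: by end_near.
Qed.

(** * The accelerated Collatz-like map *)

Section CollatzAcceleration.
Variables (p q : nat) (r : 'Z_p -> int).
Hypothesis p_gt1 : (1 < p)%N.
Hypothesis r_pos : forall j : nat, (0 < j < p)%N -> 1 <= q%:Z * j%:Z + r j%:R.
Hypothesis r_mod : forall j : nat, (0 < j < p)%N ->
  (q%:Z * j%:Z + r j%:R = 0 %[mod p%:Z])%Z.

(** [C] on [0] mod [p], and [C] followed by the division by [p] elsewhere:
    [M * p + j] goes to [q * M + (q * j + r j) / p]. *)
Definition collatz_coef (j : nat) : nat := if j == 0%N then 1%N else q.
Definition collatz_shift (j : nat) : nat :=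
  if j == 0%N then 0%N else (absz (q%:Z * j%:Z + r j%:R)%R %/ p)%N.

Let C := collatz p q r.
Let T := residue_map p collatz_coef collatz_shift.

Lemma collatz_accelerate N :
  T N = if (p %| N)%N then C N else C (C N).
Proof.
rewrite /T /residue_map /collatz_coef /collatz_shift -/(dvdn p N) /C.
case: ifPn => pN; first by rewrite /collatz pN mul1n addn0.
have p0 : (0 < p)%N := ltnW p_gt1.
pose j := (N %% p)%N.
have jP : (0 < j < p)%N by rewrite ltn_mod p0 lt0n andbT.
have rE : r N%:R = r j%:R.
  by congr r; apply: val_inj; rewrite /= !val_Zp_nat // modn_mod.
have [CE _] := collatz_nondvd p_gt1 r_pos pN.
have pos := r_pos j jP; have pdiv := r_mod j jP.
have absE : (absz (q%:Z * j%:Z + r j%:R)%R)%:Z = q%:Z * j%:Z + r j%:R.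
  by rewrite gez0_abs // (le_trans _ pos).
have pabs : (p %| absz (q%:Z * j%:Z + r j%:R)%R)%N.
  by move/eqP: pdiv; rewrite mod0z => /eqP/dvdz_mod0P; rewrite dvdzE.
set u := absz _ in absE pabs *.
have CN : collatz p q r N = ((q * (N %/ p) + u %/ p) * p)%N.
  rewrite mulnDl divnK //; apply/eqP; rewrite -eqz_nat CE rE.
  rewrite PoszD absE {1}(divn_eq N p) -/j.
  by apply/eqP; rewrite !PoszM PoszD PoszM; ring.
by rewrite CN /collatz dvdn_mull // mulnK.
Qed.

Lemma accelerated_orbit k N : exists l, iter k T N = iter l C N.
Proof.
elim: k => [|k [l IHk]]; first by exists 0%N.
rewrite iterS IHk collatz_accelerate; case: ifP => _.
  by exists l.+1.
by exists l.+2.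
Qed.

Lemma orbit_min_le_accelerated k N : (orbit_min C N <= iter k T N)%N.
Proof.
have [l ->] := accelerated_orbit k N.
rewrite /orbit_min; case: ex_minnP => m _; apply.
by apply/asboolP; exists l.
Qed.

Lemma collatz_coef_coprime : coprime p q ->
  forall j, (j < p)%N -> coprime (collatz_coef j) p.
Proof.
move=> cop j _; rewrite /collatz_coef; case: ifP => _; first exact: coprime1n.
by rewrite coprime_sym.
Qed.

Lemma sum_ln_collatz_coef (R : realType) :
  \sum_(j < p) ln (collatz_coef j)%:R = (p%:R - 1) * ln q%:R :> R.
Proof.
rewrite /collatz_coef; case: p p_gt1 => [//|n] _.
rewrite big_ord_recl /= ln1 add0r sumr_const card_ord -[n.+1%:R]natr1 addrK.
by rewrite mulr_natl.
Qed.
End CollatzAcceleration.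

Theorem theorem1p8 (R : realType) (p q : nat) (r : 'Z_p -> int)
  (hp : (2 <= p)%N) (hq : (2 <= q)%N)
  (hr : forall j : nat, (0 < j < p)%N -> 1 <= q%:Z * j%:Z + r j%:R)
  (hcop : coprime p q)
  (hqp : (q%:R : R) < (p%:R : R) `^ (p%:R / (p%:R - 1)))
  (hmod : forall j : nat, (0 < j < p)%N ->
    (q%:Z * j%:Z + r j%:R = 0 %[mod p%:Z])%Z)
  (hr0 : forall j : nat, (0 < j < p)%N -> 0 <= r j%:R) :
  let gamma : R := (p%:R - 1) / p%:R * log_base p%:R q%:R in
  forall c : R, 0 < c ->
    has_natural_density
      [set N : nat | (0 < N)%N /\
        ((orbit_min (collatz p q r) N)%:R : R) < (N%:R : R) `^ (gamma + c)]
      (1 : R).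
Proof.
move=> gamma c c_gt0.
have cop := collatz_coef_coprime p q hcop.
have sparse := high_orbit_sparse R p (collatz_coef q) (collatz_shift p q r)
  hp cop c c_gt0.
apply: density_one_of_sparse sparse => N N_gt0 notA; split=> // k.
have -> : (\sum_(j < p) ln (collatz_coef q j)%:R) / p%:R / ln p%:R = gamma :> R.
  by rewrite sum_ln_collatz_coef // /gamma /log_base; ring.
have : N%:R `^ (gamma + c) <= (orbit_min (collatz p q r) N)%:R.
  by rewrite leNgt; apply/negP => lt_min; apply: notA.
by move/le_trans; apply; rewrite ler_nat orbit_min_le_accelerated.
Qed.
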